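(* Let $n\geqslant 2$ be an integer and let $k$ be an integer with $2\leqslant k\leqslant n$. There exist uncountably many vectors $\xi\in\mathbb{R}^{n+1}$ whose coordinates are linearly independent over $\mathbb{Q}$ such that \[ \lim_{q\rightarrow \infty} \frac{L_{\xi,k-1}(q)}{q} =0 \quad \text{and} \quad \liminf_{q\rightarrow \infty} \frac{L_{\xi,k+1}(q)}{q} = \frac{1}{n-k+2}. \]
   Context: For a non-zero $\xi\in\mathbb{R}^{n+1}$ and $Q\geqslant 1$, let $\mathcal{C}_{\xi}(Q)=\{\mathbf{x}\in\mathbb{R}^{n+1} : \Vert\mathbf{x}\Vert\leqslant 1,\ |\mathbf{x}\cdot\xi|\leqslant Q^{-1}\}$, where $\mathbf{x}\cdot\mathbf{y}$ is the standard scalar product on $\mathbb{R}^{n+1}$ and $\Vert\cdot\Vert$ the Euclidean norm. For a convex body $\mathcal{C}$ and a lattice $\Lambda$ in $\mathbb{R}^{n+1}$, $\lambda_j(\mathcal{C};\Lambda)$ denotes the $j$-th successive minimum, i.e. the smallest $\lambda\geqslant 0$ such that $\lambda\mathcal{C}$ contains at least $j$ linearly independent elements of $\Lambda$. Define $L_{\xi,j}(q)=\log\lambda_j(\mathcal{C}_{\xi}(e^{q});\mathbb{Z}^{n+1})$ for $q\geqslant 0$ and $1\leqslant j\leqslant n+1$. *)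

(* Defs.v *)
From HB Require Import structures.
From mathcomp Require Import all_boot all_order all_algebra.
From mathcomp Require Import all_classical all_reals all_analysis.

Set Implicit Arguments.
Unset Strict Implicit.
Unset Printing Implicit Defensive.

Import Order.TTheory GRing.Theory Num.Theory.
Import numFieldNormedType.Exports.

Local Open Scope classical_set_scope.
Local Open Scope ring_scope.

Section ParametricGeometryOfNumbers.
Context {R : realType} {m : nat}.
Implicit Types (x y xi : 'rV[R]_m) (C Lambda : set 'rV[R]_m).

Definition dot x y : R := \sum_(i < m) x 0 i * y 0 i.

(* The canonical norm `|x| on 'rV[R]_m is the sup norm, hence this definition. *)
Definition enorm x : R := Num.sqrt (dot x x).

Definition int_lattice : set 'rV[R]_m :=
  [set x | forall i, x 0 i \is a Num.int].

Definition rat_independent xi : Prop :=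
  forall a : 'I_m -> rat,
    \sum_(i < m) ratr (a i) * xi 0 i = 0 -> forall i, a i = 0.

Definition dilate (lambda : R) C : set 'rV[R]_m := [set lambda *: x | x in C].

Definition contains_independent (j : nat) (A : set 'rV[R]_m) : Prop :=
  exists M : 'M[R]_(j, m), row_free M /\ forall i, A (row i M).

Definition minimum_candidates C Lambda (j : nat) : set R :=
  [set lambda | 0 <= lambda /\
                contains_independent j (dilate lambda C `&` Lambda)].

Definition successive_minimum C Lambda (j : nat) : R :=
  inf (minimum_candidates C Lambda j).

(* The infimum is the smallest candidate whenever there is one, which is the
   case when C is a convex body, Lambda a full lattice and j <= m. *)
Lemma successive_minimum_smallest C Lambda j lambda :
  minimum_candidates C Lambda j lambda ->
  lbound (minimum_candidates C Lambda j) lambda ->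
  successive_minimum C Lambda j = lambda.
Proof.
move=> Al lbl; apply/eqP; rewrite eq_le; apply/andP; split.
  by apply: ge_inf => //; exists lambda.
by apply: lb_le_inf => //; exists lambda.
Qed.

Definition convex_body xi (Q : R) : set 'rV[R]_m :=
  [set x | enorm x <= 1 /\ `|dot x xi| <= Q^-1].

Definition log_minimum xi (j : nat) (q : R) : R :=
  ln (successive_minimum (convex_body xi (expR q)) int_lattice j).

End ParametricGeometryOfNumbers.

(* Main.v *)
Require Import Defs.
From mathcomp Require Import all_boot all_order all_algebra.
From mathcomp Require Import all_classical all_reals all_analysis.
From mathcomp Require Import fingroup perm zify ring lra.
Import Order.TTheory GRing.Theory Num.Theory.
Import numFieldNormedType.Exports.

(** Write D = n - k + 2.  The vector xi is built from a sequence of bases of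
    Z^(n+1), each obtained from the previous one by subtracting from one basis
    vector (the mover) a power of 2 times another (the next mover).  The dual
    bases then change by adding nonnegative multiples, so they span nested cones
    and xi is taken in their intersection.  A basis vector x_i of size about
    2^(e_i) stays small against xi until it becomes the mover, which gives at
    every q a basis whose n+1 trajectories max(log|x|, q + log|x.xi|) sum up to
    q + O(1).  A determinant bound shows that these are the successive minima up
    to O(1), so that the L_j are read off the levels e_i.

    In the schedule of movers the D-1 positions k..n grow together, with levels
    about (D+1) t^2 in cycle t.  The k positions below k stay put, except that
    at the rare times t = 2^(2^r) one of them, in rotation, is raised to the
    level of the growing ones.  Thus at any time at most one of these k
    positions is not negligible, hence L_(k-1) = o(q) and L_(k+1) >= q/D - o(q),
    while right after each of these times D positions share the same level, so
    that L_(k+1) = q/D + o(q).  Since all levels tend to infinity, xi has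
    rationally independent coordinates, and every c xi with 1 <= c <= 2 has the
    same properties. *)

(** * Levels of the positions and their total weight *)

Section Levels.
Local Open Scope nat_scope.
Context {m : nat} (mover : nat -> 'I_m) (target : nat -> nat).

Fixpoint level (s : nat) (i : 'I_m) : nat :=
  if s is s'.+1 then if i == mover s' then target s' else level s' i else 0.

Definition weight (s : nat) : nat := \sum_i level s i.

Lemma level_setP s i : level s i = 0 \/
  exists s', [/\ s' < s, mover s' = i & level s i = target s'].
Proof.
elim: s => [|s IHs] /=; first by left.
case: eqP => [->|_]; first by right; exists s.
by case: IHs => [->|[s' [lt_s's ms' ->]]]; [left|right; exists s'; split=> //; lia].
Qed.

Lemma level_leP s i c : (forall s', s' < s -> mover s' = i -> target s' <= c) ->
  level s i <= c.
Proof.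
by move=> tc; have [->//|[s' [ls ms' ->]]] := level_setP s i; exact: tc.
Qed.

Hypothesis target_homo : {homo target : s t / s <= t}.

Lemma level_le_target s i : level s i <= target s.
Proof. by apply: level_leP => s' s's _; apply: target_homo; exact: ltnW. Qed.

Lemma target_le_level s s' i : s' < s -> mover s' = i -> target s' <= level s i.
Proof.
elim: s => // s IHs; rewrite ltnS leq_eqVlt => /orP[/eqP->|lts] ms' /=.
  by rewrite -ms' eqxx.
by case: eqP => _; [exact/target_homo/ltnW|exact: IHs].
Qed.

End Levels.

(** * The cyclic schedule of movers and its rare times *)

Section Schedule.
Local Open Scope nat_scope.
Context (n k : nat).
Hypotheses (k_gt1 : 1 < k) (le_kn : k <= n).

Local Notation D := (n - k + 2).

(* The factor D.+1 makes consecutive heights differ by s + 2 at every step s of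
   cycle t = s %/ D, see level_gap. *)
Definition height (t : nat) : nat := D.+1 * t ^ 2.
(** For [t > 1], the largest r with 2^(2^r) <= t, which numbers the last rare time up to [t]. Modulo
    [k] it is the one position below [k] whose level may be large. *)
Definition loglog (t : nat) : nat := trunc_log 2 (trunc_log 2 t).

(* In an ordinary cycle the last mover is also the first mover of the next
   cycle, so that the corresponding basis change is the identity. *)
Definition mover (s : nat) : 'I_n.+1 :=
  let t := s %/ D in let i := s %% D in
  if i.+1 < D then inord (k + i)
  else if t == 2 ^ 2 ^ loglog t then inord (loglog t %% k) else inord k.

Definition target (s : nat) : nat := height (s %/ D).+1.

Lemma height_homo : {homo height : s t / s <= t}.
Proof. by move=> s t st; rewrite leq_mul2l leq_exp2r ?st ?orbT. Qed.

Lemma target_homo : {homo target : s t / s <= t}.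
Proof. by move=> s t st; apply: height_homo; rewrite ltnS leq_div2r. Qed.

Lemma loglogK r : loglog (2 ^ 2 ^ r) = r.
Proof. by rewrite /loglog !trunc_expnK. Qed.

Lemma loglog_homo : {homo loglog : s t / s <= t}.
Proof. by move=> s t st; rewrite /loglog !leq_trunc_log. Qed.

Lemma loglog_le t : 1 < t -> 2 ^ 2 ^ loglog t <= t.
Proof.
move=> t1; apply: leq_trans (trunc_logP (isT : 1 < 2) (ltnW t1)).
rewrite leq_exp2l //; apply: trunc_logP => //.
by rewrite -(@trunc_expnK 2 1) // leq_trunc_log.
Qed.

Lemma moverP s :
  [\/ k <= mover s /\ nat_of_ord (mover s) = k + s %% D /\ s %% D < D.-1,
      [/\ mover s < k, nat_of_ord (mover s) = loglog (s %/ D) %% k,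
        s %/ D = 2 ^ 2 ^ loglog (s %/ D) & s %% D = D.-1] |
      [/\ nat_of_ord (mover s) = k, s %% D = D.-1 & mover s.+1 = mover s]].
Proof.
have D0 : 0 < D by lia.
have := ltn_pmod s D0; have km := ltn_pmod (loglog (s %/ D)) (ltnW k_gt1).
move=> sD; have mE : mover s = if (s %% D).+1 < D then inord (k + s %% D)
  else if s %/ D == 2 ^ 2 ^ loglog (s %/ D) then inord (loglog (s %/ D) %% k)
  else inord k by [].
case: ifP mE => [iD|iD] mE.
  apply: Or31; rewrite mE; move: (s %% D) iD => i iD.
  by rewrite inordK; lia.
have iDE : s %% D = D.-1 by move: (s %% D) iD sD => i; lia.
case: eqP mE => [E|_] mE.
  by apply: Or32; rewrite mE inordK; [split|lia].
have sE : s.+1 = (s %/ D).+1 * D by rewrite {1}(divn_eq s D) iDE mulSn; lia.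
apply: Or33; rewrite mE inordK ?ltnS //; split=> //.
by rewrite sE /mover modnMl ifT ?addn0 //; lia.
Qed.

Lemma cycle_bounds s : (s %/ D) * D <= s < (s %/ D).+1 * D.
Proof. by rewrite leq_divM ltn_ceil // addn2. Qed.

Lemma same_cycle s' s : s' < s -> s' %/ D = s %/ D -> s' %% D < s %% D.
Proof.
by move=> lt E; move: lt; rewrite {1}(divn_eq s' D) {1}(divn_eq s D) E ltn_add2l.
Qed.

(** A position moves at most once per cycle, apart from the idle step that the hypothesis excludes,
    so any earlier move of this mover took place in an earlier cycle. *)
Lemma level_before_move s : mover s.+1 <> mover s ->
  level mover target s (mover s) <= height (s %/ D).
Proof.
move=> ms; apply: level_leP => s' ls ms'; apply: height_homo.
have := leq_div2r D (ltnW ls); rewrite leq_eqVlt => /orP[/eqP E|//].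
have lti := same_cycle s' s ls E.
move: lti.
have := moverP s; have := moverP s'; rewrite ms'.
move: (s %% D) (s' %% D) (loglog _ %% k) => i i' l.
case=> [[_ [-> i'D]]|[mk _ _ i'D]|[mk i'D _]].
- case=> [[_ [E2 iD]]|[]|[_ _ /ms//]]; lia.
- case=> [[_ [E2 iD]]|[_ _ _ ->]|[_ _ /ms//]]; lia.
- case=> [[_ [E2 iD]]|[_ _ _ ->]|[_ _ /ms//]]; lia.
Qed.

Lemma level_gap s : mover s.+1 != mover s ->
  level mover target s (mover s) + s + 2 <= target s.
Proof.
move=> /eqP /level_before_move H.
apply: leq_trans (_ : height (s %/ D) + s + 2 <= _).
  by rewrite !leq_add2r.
(* Cycle t raises the height by (D+1)(2t+1) >= (t+1)D + 1, and s < (t+1)D. *)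
have := cycle_bounds s; rewrite /target /height; set t := s %/ D; nia.
Qed.

Lemma mover_lt j t : (j.+1 < D) -> mover (t * D + j) = inord (k + j).
Proof.
move=> jD; rewrite /mover modnMDl modn_small ?jD //; lia.
Qed.

Lemma mover_last r : mover ((2 ^ 2 ^ r) * D + D.-1) = inord (r %% k).
Proof.
have DE : D.-1 < D by lia.
rewrite /mover divnMDl ?modnMDl; last by lia.
rewrite (divn_small DE) modn_small // addn0 loglogK eqxx ifF //; lia.
Qed.

Lemma leq_exp2exp r : r <= 2 ^ 2 ^ r.
Proof. by apply: ltnW; apply: ltn_trans (ltn_expl r _) (ltn_expl _ _). Qed.

Lemma mover_recurrent (i : 'I_n.+1) s : exists2 t, s <= t & mover t = i.
Proof.
have [lt_ik|le_ki] := ltnP i k.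
  (* The rare time numbered r = s k + i raises position r mod k = i, and r >= s. *)
  exists ((2 ^ 2 ^ (s * k + i)) * D + D.-1).
    have := leq_exp2exp (s * k + i); nia.
  by rewrite mover_last modnMDl modn_small // inord_val.
have [iD|iD] := ltnP (i - k).+1 D.
  exists (s * D + (i - k)); first by nia.
  by rewrite mover_lt // subnKC // inord_val.
have := ltn_ord i; lia.
Qed.

(** Step [i - k] of the preceding cycle took position [i] to the present height; in the first cycle
    this height is 0. *)
Lemma height_le_level s (i : 'I_n.+1) : k <= i ->
  height (s %/ D) <= level mover target s i.
Proof.
move=> ki; have := cycle_bounds s; set t := s %/ D.
case: t => [|t] ts; first by rewrite /height muln0.
have iD : (i - k).+1 < D by have := ltn_ord i; lia.
have -> : height t.+1 = target (t * D + (i - k)).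
  by rewrite /target divnMDl ?divn_small ?addn0 ?addn2 //; lia.
apply: target_le_level; first exact: target_homo.
  by nia.
by rewrite mover_lt // subnKC // inord_val.
Qed.

(** Let t be the current cycle. Such a position can only have risen at a rare time t' numbered below
    [loglog t]. Each rare time is the square of the one before, so t'^2 <= t, and a height quadratic
    in t' is only linear in t. *)
Lemma small_level s (i : 'I_n.+1) : i < k ->
    nat_of_ord i <> loglog (s %/ D) %% k ->
  level mover target s.+1 i <= 4 * D.+1 * (s %/ D).
Proof.
move=> ik iz; apply: level_leP => s' ls ms'.
have tt' : s' %/ D <= s %/ D by apply: leq_div2r.
have := moverP s'; rewrite ms'; case=> [[]||[]]; [lia| |lia].
move=> [_ iE t'E _]; rewrite /target.
have := loglog_homo _ _ tt'; rewrite leq_eqVlt => /orP[/eqP E|rr].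
  by case: iz; rewrite -E.
have t'2 : 2 <= s' %/ D by rewrite t'E (leq_exp2l 1) // expn_gt0.
have t2 : 1 < s %/ D by apply: leq_trans tt'.
have sq : (s' %/ D) ^ 2 <= s %/ D.
  apply: leq_trans (loglog_le _ t2).
  rewrite t'E -expnM -expnSr leq_exp2l // leq_exp2l //.
have : (s' %/ D).+1 ^ 2 <= 4 * (s' %/ D) ^ 2.
  by rewrite -[4]/(2 ^ 2) -expnMn leq_exp2r; lia.
rewrite /height; nia.
Qed.

Lemma height_le_weight s : height (s %/ D) <= weight mover target s.
Proof.
have lk : k < n.+1 by [].
rewrite /weight (bigD1 (Ordinal lk)) //=.
by apply: leq_trans (leq_addr _ _); exact: height_le_level.
Qed.

Lemma level_le_height s i : level mover target s.+1 i <= height (s %/ D).+1.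
Proof. by apply: level_leP => s' ls _; apply: target_homo. Qed.

Lemma card_large (z : 'I_n.+1) : z < k ->
  #|[set i : 'I_n.+1 | (k <= i) || (i == z)]| = D.
Proof.
move=> zk.
have -> : [set i : 'I_n.+1 | (k <= i) || (i == z)] = z |: [set i : 'I_n.+1 | k <= i].
  by apply/setP => i; rewrite !inE orbC.
rewrite cardsU1 inE /= leqNgt zk /=.
have := cardsC [set i : 'I_n.+1 | k <= i].
have -> : ~: [set i : 'I_n.+1 | k <= i] =
    [set widen_ord (leqW le_kn) j | j in 'I_k].
  apply/setP => i; rewrite !inE -ltnNge.
  apply/idP/imsetP => [ik|[j _ -> /=]]; last exact: ltn_ord.
  by exists (Ordinal ik) => //; exact: val_inj.
rewrite card_imset ?[#|_|](card_ord n.+1) ?card_ord.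
  by move: #|_| => a; lia.
by move=> i j /(congr1 val) /= E; exact: val_inj.
Qed.

(** Only the D positions of [card_large] can come near the current height; [small_level] bounds each
    of the others by a term linear in the cycle. *)
Lemma weight_le s : weight mover target s.+1 <=
  n.+1 * (4 * D.+1 * (s %/ D)) + D * height (s %/ D).+1.
Proof.
set c := 4 * _ * _; set h := height _.
have zk : loglog (s %/ D) %% k < k by rewrite ltn_mod ltnW.
have zn : loglog (s %/ D) %% k < n.+1 by lia.
rewrite -(card_large (Ordinal zn) zk); set S := [set _ | _].
have -> : n.+1 * c = \sum_(i < n.+1) c by rewrite sum_nat_const card_ord.
have -> : #|S| * h = \sum_(i < n.+1) (if i \in S then h else 0).
  by rewrite -big_mkcond sum_nat_const.
rewrite -big_split; apply: leq_sum => i _ /=.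
have [_|] := boolP (i \in S).
  by apply: leq_trans (level_le_height s i) (leq_addl _ _).
rewrite inE negb_or -ltnNge addn0 => /andP[ik /eqP iz].
by apply: small_level => // E; apply: iz; exact: val_inj.
Qed.

(** The rare cycle [t = 2 ^ 2 ^ M] is complete at stage [t.+1 * D]: the positions from [k] on and
    position [M %% k] have then all moved in it, to the same height. *)
Lemma saturated M : exists s t, [/\ M <= t,
  forall i, level mover target s i <= height t.+1 &
  D * height t.+1 <= weight mover target s].
Proof.
pose t := 2 ^ 2 ^ M; exists (t.+1 * D), t; split; first exact: leq_exp2exp.
  move=> i; apply: level_leP => s' ls _; apply: height_homo.
  by rewrite ltnS -ltnS ltn_divLR // addn2.
have zk : M %% k < k by rewrite ltn_mod ltnW.
have zn : M %% k < n.+1 by lia.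
rewrite -[X in X * _](card_large (Ordinal zn) zk) -sum_nat_const big_mkcond.
apply: leq_sum => i _; case: ifP => //; rewrite inE => /orP[ki|/eqP ->].
  by have := @height_le_level (t.+1 * D) _ ki; rewrite mulnK ?addn2.
have -> : height t.+1 = target (t * D + D.-1).
  by rewrite /target divnMDl ?divn_small ?addn0 ?addn2.
apply: target_le_level; first exact: target_homo.
  by rewrite mulSn; lia.
rewrite mover_last; apply: val_inj; rewrite /= inordK //.
Qed.

End Schedule.

Local Open Scope classical_set_scope.
Local Open Scope ring_scope.

(** * Euclidean norm and dilates of the convex body *)

Section Norm.
Context {R : realType} {m : nat}.
Implicit Types (x : 'rV[R]_m).

Lemma dot_ge0 x : 0 <= dot x x.
Proof. by apply: sumr_ge0 => i _; rewrite -expr2 sqr_ge0. Qed.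

Lemma coord_le_enorm x i : `|x 0 i| <= enorm x.
Proof.
rewrite /enorm -sqrtr_sqr ler_sqrt ?dot_ge0 // /dot (bigD1 i) //= -expr2.
by rewrite lerDl; apply: sumr_ge0 => j _; rewrite -expr2 sqr_ge0.
Qed.

Lemma enorm_le_sum x : enorm x <= \sum_j `|x 0 j|.
Proof.
have s0 : 0 <= \sum_j `|x 0 j| by apply: sumr_ge0.
rewrite /enorm -(ger0_norm s0) -sqrtr_sqr ler_sqrt ?sqr_ge0 // expr2 mulr_suml.
apply: ler_sum => i _; rewrite -expr2 -normr_id -real_normK ?num_real // expr2.
rewrite normr_id ler_wpM2l // (bigD1 i) //= lerDl; exact: sumr_ge0.
Qed.

Lemma dotZl (a : R) x y : dot (a *: x) y = a * dot x y.
Proof. by rewrite /dot mulr_sumr; apply: eq_bigr => i _; rewrite mxE mulrA. Qed.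

Lemma dotC x y : dot x y = dot y x.
Proof. by apply: eq_bigr => i _; rewrite mulrC. Qed.

Lemma enormZ (a : R) x : 0 <= a -> enorm (a *: x) = a * enorm x.
Proof.
move=> a0; rewrite /enorm dotZl dotC dotZl mulrA -expr2.
by rewrite sqrtrM ?sqr_ge0 // sqrtr_sqr ger0_norm.
Qed.

Lemma enorm_ge1 x : int_lattice x -> x != 0 -> 1 <= enorm x.
Proof.
move=> ix; case/rV0Pn => i xi0; apply: le_trans (coord_le_enorm x i).
by rewrite norm_intr_ge1.
Qed.

Lemma dilate_convex_bodyP (xi : 'rV[R]_m) (Q l : R) x : 0 < l ->
  dilate l (convex_body xi Q) x <-> enorm x <= l /\ `|dot x xi| <= l / Q.
Proof.
move=> l0; have l0' := ltW l0; split=> [[y [ny dy] <-]|[nx dx]].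
  rewrite enormZ // dotZl normrM (ger0_norm l0'); split.
    by rewrite ler_piMr.
  by rewrite ler_wpM2l.
exists (l^-1 *: x); last by rewrite scalerA divff ?gt_eqF // scale1r.
split; first by rewrite enormZ ?invr_ge0 // mulrC ler_pdivrMr // mul1r.
by rewrite dotZl normrM ger0_norm ?invr_ge0 // mulrC ler_pdivrMr // mulrC.
Qed.

End Norm.

(** * Determinant estimates *)

Section Determinant.
Context {R : realType} {m : nat}.

Lemma det_le (A : 'M[R]_m) (a b : 'I_m -> R) :
    (forall i j, `|A i j| <= a i * b j) ->
  `|\det A| <= m`!%:R * (\prod_i a i * \prod_j b j).
Proof.
move=> Aab; rewrite /determinant.
apply: le_trans (ler_norm_sum _ _ _) _.
have -> : m`!%:R = \sum_(s : 'S_m) 1 :> R by rewrite sumr_const card_Sn.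
rewrite mulr_suml; apply: ler_sum => s _; rewrite mul1r.
rewrite normrM normr_sign mul1r normr_prod.
rewrite [\prod_j b j](reindex_inj (@perm_inj _ s)) /= -big_split /=.
by apply: ler_prod => i _; rewrite normr_ge0 Aab.
Qed.

(** Cramer's rule. With x = xi it brings in a column of small forms. *)
Lemma det_replace_col (A : 'M[R]_m) (x : 'I_m -> R) l :
  \det (\matrix_(i, j) if j == l then \sum_h A i h * x h else A i j) = x l * \det A.
Proof.
set B := \matrix_(_, _) _; rewrite (expand_det_col B l).
have BA i : cofactor B i l = cofactor A i l.
  rewrite /cofactor; congr (_ * \det _); apply/matrixP => i' j'.
  by rewrite !mxE eq_sym (negbTE (neq_lift _ _)).
under eq_bigr do rewrite BA mxE eqxx mulr_suml.
rewrite exchange_big /=; transitivity (\sum_j x j * (\adj A *m A) l j).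
  apply: eq_bigr => j _; rewrite mxE mulr_sumr; apply: eq_bigr => i _.
  rewrite !mxE; ring.
rewrite mul_adj_mx (bigD1 l) //= mxE eqxx big1 ?addr0 // => j jl.
by rewrite mxE eq_sym (negbTE jl) mulr0.
Qed.

(** For invertible [A] the right side is [\det A] times the coordinate [r] of [v] in the basis of
    rows of [A]. *)
Lemma det_replace_row (A : 'M[R]_m) (v : 'rV[R]_m) r :
  \det (\matrix_(i, j) if i == r then v 0 j else A i j) = (v *m \adj A) 0 r.
Proof.
set B := \matrix_(_, _) _; rewrite (expand_det_row B r) mxE.
apply: eq_bigr => j _; rewrite mxE eqxx mxE; congr (_ * _).
rewrite /cofactor; congr (_ * \det _); apply/matrixP => i' j'.
by rewrite !mxE eq_sym (negbTE (neq_lift _ _)).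
Qed.

Lemma det_int (A : 'M[R]_m) : (forall i j, A i j \is a Num.int) ->
  \det A \is a Num.int.
Proof.
move=> iA; apply: rpred_sum => s _; apply: rpredM.
  by rewrite rpredX ?rpredN ?rpred1.
by apply: rpred_prod.
Qed.

(** Replacing column j by the forms [dot (row i A) xi] multiplies the determinant, an integer of
    absolute value at least 1, by xi_j, and gives that column a factor 1/Q. The resulting bounds on
    xi_j Q are summed over j. *)
Lemma int_det_lower (A : 'M[R]_m) (l : 'I_m -> R) (xi : 'rV[R]_m) (Q : R) :
    (forall i j, A i j \is a Num.int) -> \det A != 0 -> 0 < Q ->
    (forall i, enorm (row i A) <= l i) ->
    (forall i, `|dot (row i A) xi| <= l i / Q) -> 1 <= \sum_i xi 0 i ->
  Q <= m%:R * m`!%:R * \prod_i l i.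
Proof.
move=> iA A0 Q0 nA dA xi1.
have dA1 : 1 <= `|\det A| by rewrite norm_intr_ge1 ?det_int.
suff H (j : 'I_m) : xi 0 j * Q <= m`!%:R * \prod_i l i.
  rewrite -(ler_pM2r Q0) mul1r in xi1; apply: le_trans xi1 _.
  rewrite mulr_suml -mulrA; apply: le_trans (ler_sum _ (fun i _ => H i)) _.
  by rewrite sumr_const card_ord -[leLHS]mulr_natl.
have [x0|x0] := leP (xi 0 j) 0.
  apply: (@le_trans _ _ 0); first by rewrite pmulr_lle0.
  apply: mulr_ge0 => //; apply: prodr_ge0 => i _.
  by apply: le_trans (nA i); rewrite sqrtr_ge0.
have := det_replace_col A (fun h => xi 0 h) j; set B := \matrix_(_, _) _ => dB.
have : `|\det B| <= m`!%:R * (\prod_i l i * \prod_h (if h == j then Q^-1 else 1)).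
  apply: det_le => i h; rewrite mxE; case: eqP => _.
    suff -> : \sum_h0 A i h0 * xi 0 h0 = dot (row i A) xi by exact: dA.
    by apply: eq_bigr => h' _; rewrite mxE.
  rewrite mulr1; apply: le_trans (nA i).
  by have := coord_le_enorm (row i A) h; rewrite mxE.
rewrite -big_mkcond big_pred1_eq dB normrM gtr0_norm // mulrA ler_pdivlMr //.
apply: le_trans; rewrite mulrAC ler_peMr // mulr_ge0 ?ltW //.
Qed.

End Determinant.

(** * Bases of the integer lattice and their duals *)

Section Bases.
Context (R : realType) {n : nat} (p : nat -> 'I_n.+1) (b : nat -> nat).
Local Notation e := (level p b).

(* The levels never exceed b s, so the subtraction is not truncated. *)
Definition multiplier (s : nat) : R :=
  if p s.+1 == p s then 0 else 2 ^+ (b s - e s (p s.+1)).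

Fixpoint lattice_basis (s : nat) : 'M[R]_n.+1 :=
  if s is s'.+1
  then (1%:M - multiplier s' *: delta_mx (p s') (p s)) *m lattice_basis s'
  else 1%:M.

Fixpoint dual_basis (s : nat) : 'M[R]_n.+1 :=
  if s is s'.+1
  then (1%:M + multiplier s' *: delta_mx (p s) (p s')) *m dual_basis s'
  else 1%:M.

Definition rest (s : nat) : nat := \sum_(i | i != p s) e s i.

Lemma multiplier_ge0 s : 0 <= multiplier s.
Proof. by rewrite /multiplier; case: ifP => // _; rewrite exprn_ge0. Qed.

Lemma delta_mulmxE (c : R) (i0 j0 : 'I_n.+1) (A : 'M[R]_n.+1) i j :
  ((c *: delta_mx i0 j0) *m A) i j = (i == i0)%:R * c * A j0 j.
Proof.
rewrite -scalemxAl mxE mxE (bigD1 j0) //= mxE eqxx andbT big1 ?addr0 => [|h hj].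
  by rewrite mulrCA mulrA.
by rewrite mxE (negbTE hj) andbF mul0r.
Qed.

Lemma basisS s i j : lattice_basis s.+1 i j =
  lattice_basis s i j - (i == p s)%:R * multiplier s * lattice_basis s (p s.+1) j.
Proof. by rewrite /= mulmxBl mul1mx mxE [in X in _ + X]mxE delta_mulmxE. Qed.

Lemma dual_basisS s i j : dual_basis s.+1 i j =
  dual_basis s i j + (i == p s.+1)%:R * multiplier s * dual_basis s (p s) j.
Proof. by rewrite /= mulmxDl mul1mx mxE delta_mulmxE. Qed.

Lemma basis_dualK s : lattice_basis s *m (dual_basis s)^T = 1%:M.
Proof.
elim: s => [|s IHs] /=; first by rewrite trmx1 mulmx1.
rewrite trmx_mul !mulmxA -(mulmxA _ (lattice_basis s)) IHs mulmx1.
have tE (c : R) i j : (c *: delta_mx i j : 'M[R]_n.+1)^T = c *: delta_mx j i.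
  by rewrite linearZ /= trmx_delta.
rewrite linearD /= trmx1 tE mulmxDr mulmx1.
rewrite mulmxBl mul1mx -scalemxAl -scalemxAr.
(* The quadratic term vanishes: the two indices differ, or else the multiplier is 0. *)
have -> : multiplier s *: (multiplier s *:
    (delta_mx (p s) (p s.+1) *m delta_mx (p s) (p s.+1))) = 0 :> 'M[R]_n.+1.
  rewrite /multiplier; case: eqP => [_|/eqP ne]; first by rewrite scale0r.
  by rewrite mul_delta_mx_0 // !scaler0.
by rewrite subr0 subrK.
Qed.

Lemma dual_basisK s : (dual_basis s)^T *m lattice_basis s = 1%:M.
Proof. exact/mulmx1C/basis_dualK. Qed.

Lemma lattice_basis_int s i j : lattice_basis s i j \is a Num.int.
Proof.
elim: s i j => [|s IHs] i j; first by rewrite mxE rpred_nat.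
rewrite basisS rpredB // !rpredM // ?rpred_nat // /multiplier.
by case: ifP => _; [exact: rpred0|apply: rpredX; exact: rpred_nat].
Qed.

Lemma dual_basis_ge0 s i j : 0 <= dual_basis s i j.
Proof.
elim: s i j => [|s IHs] i j; first by rewrite mxE.
by rewrite dual_basisS addr_ge0 // !mulr_ge0 // multiplier_ge0.
Qed.

(* Later dual vectors stay in the cone spanned by the earlier ones. *)
Lemma basis_mul_dual_ge0 s d i j :
  0 <= (lattice_basis s *m (dual_basis (s + d))^T) i j.
Proof.
elim: d j => [|d IHd] j; first by rewrite addn0 basis_dualK mxE.
rewrite addnS mxE.
have E h : lattice_basis s i h * (dual_basis (s + d).+1)^T h j =
    lattice_basis s i h * (dual_basis (s + d))^T h j + (j == p (s + d).+1)%:R *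
    multiplier (s + d) *
    (lattice_basis s i h * (dual_basis (s + d))^T h (p (s + d))).
  by rewrite mxE dual_basisS !mxE; ring.
under eq_bigr do rewrite E.
rewrite big_split /= -mulr_sumr.
have IH j' := IHd j'; move: (IH j) (IH (p (s + d))); rewrite !mxE => H1 H2.
by rewrite addr_ge0 // !mulr_ge0 // multiplier_ge0.
Qed.

Lemma weight_rest s : weight p b s = (e s (p s) + rest s)%N.
Proof. by rewrite /weight (bigD1 (p s)). Qed.

Lemma weightS s : weight p b s.+1 = (b s + rest s)%N.
Proof.
rewrite /weight (bigD1 (p s)) //= eqxx; congr (_ + _)%N.
by apply: eq_bigr => i /negbTE ->.
Qed.

Context (b_homo : {homo b : s t / (s <= t)%N}).
Context (gap : forall s, p s.+1 != p s -> (e s (p s) + s + 2 <= b s)%N).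

Lemma levelS_other s i : i != p s -> e s.+1 i = e s i.
Proof. by move=> /= /negbTE ->. Qed.

Lemma level_le_b s i : (e s i <= b s)%N.
Proof. exact: level_le_target. Qed.

Lemma weight_homo : {homo weight p b : s t / (s <= t)%N}.
Proof.
apply: homo_leq => [//|x y z|s]; first exact: leq_trans.
by rewrite weight_rest weightS leq_add2r level_le_b.
Qed.

(* The gap condition lets the factor 2 - 2^-s absorb the error of each step, so
   that the constants stay bounded. *)
Lemma basis_norm_le s i :
  \sum_j `|lattice_basis s i j| <= (2 - 2^-1 ^+ s) * 2 ^+ e s i.
Proof.
elim: s i => [|s IHs] i.
  rewrite expr0 mulr1 (bigD1 i) //= big1 => [|j ji]; rewrite !mxE ?eqxx.
    by rewrite normr1; lra.
  by rewrite eq_sym (negbTE ji) normr0.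
have h0 : 0 < 2^-1 ^+ s :> R by rewrite exprn_gt0.
have h1 : 2^-1 ^+ s <= 1 :> R by apply: exprn_ile1; lra.
have old : \sum_j `|lattice_basis s i j| <= (2 - 2^-1 ^+ s.+1) * 2 ^+ e s i.
  apply: le_trans (IHs i) _; rewrite ler_pM2r ?exprn_gt0 // exprS; lra.
under eq_bigr do rewrite basisS.
have [iE|ip] := eqVneq i (p s); last first.
  under eq_bigr do rewrite mul0r mul0r subr0.
  by rewrite levelS_other.
rewrite /= iE eqxx; under eq_bigr do rewrite mul1r.
move: old; rewrite iE /multiplier; have [Ep|np] := eqVneq (p s.+1) (p s) => old.
  under eq_bigr do rewrite mul0r subr0.
  apply: le_trans old _; rewrite ler_wpM2l ?ler_weXn2l ?level_le_b ?ler1n //.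
  rewrite exprS; lra.
set N := 2 ^+ (_ - _).
have tri : \sum_j `|lattice_basis s (p s) j - N * lattice_basis s (p s.+1) j| <=
    \sum_j `|lattice_basis s (p s) j| + N * \sum_j `|lattice_basis s (p s.+1) j|.
  rewrite mulr_sumr -big_split /=; apply: ler_sum => j _.
  apply: le_trans (ler_normB _ _) _; rewrite normrM (@ger0_norm _ N) //.
  by rewrite exprn_ge0.
apply: le_trans tri _.
have N0 : 0 <= N by rewrite exprn_ge0.
have H1 := IHs (p s); have H2 := ler_wpM2l N0 (IHs (p s.+1)).
apply: le_trans (lerD H1 H2) _.
have -> : N * ((2 - 2^-1 ^+ s) * 2 ^+ e s (p s.+1)) = (2 - 2^-1 ^+ s) * 2 ^+ b s.
  by rewrite mulrCA -exprD subnK ?level_le_b.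
have : 2 ^+ e s (p s) <= 2^-1 ^+ s.+2 * 2 ^+ b s :> R.
  rewrite exprVn mulrC ler_pdivlMr ?exprn_gt0 // -exprD ler_weXn2l ?ler1n //.
  by have := gap s np; lia.
have : 0 < 2 ^+ e s (p s) :> R by rewrite exprn_gt0.
move: h0; rewrite !exprS.
move: (2^-1 ^+ s) (2 ^+ b s) (2 ^+ e s (p s)) => h B E h0 E0 EB.
have : 0 < h * E by rewrite mulr_gt0.
lra.
Qed.

Lemma dual_sum_ge s : 2 ^+ rest s <= \sum_j dual_basis s (p s) j.
Proof.
elim: s => [|s IHs].
  rewrite /rest big1 // expr0 (bigD1 (p 0%N)) //= mxE eqxx lerDl.
  by apply: sumr_ge0 => j _; rewrite mxE.
under eq_bigr do rewrite dual_basisS eqxx mul1r.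
rewrite big_split /= -mulr_sumr /multiplier.
have [Ep|np] := eqVneq (p s.+1) (p s).
  rewrite mul0r addr0 Ep.
  suff -> : rest s.+1 = rest s by [].
  by rewrite /rest Ep; apply: eq_bigr => i /levelS_other.
have -> : rest s.+1 = (b s - e s (p s.+1) + rest s)%N.
  have := weight_rest s.+1; rewrite weightS (levelS_other _ _ np).
  by have := level_le_b s (p s.+1); lia.
rewrite exprD.
apply: le_trans
  (_ : _ <= 2 ^+ (b s - e s (p s.+1)) * \sum_j dual_basis s (p s) j) _.
  by rewrite ler_wpM2l ?exprn_ge0.
by rewrite lerDr sumr_ge0 // => j _; rewrite dual_basis_ge0.
Qed.

End Bases.

(** * The vector in the intersection of the dual cones *)

Lemma linear_form_continuous (R : realType) m (a : 'I_m -> R) :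
  continuous (fun x : 'rV[R]_m => \sum_j a j * x 0 j).
Proof.
have C j : continuous (fun x : 'rV[R]_m => a j * x 0 j).
  move=> x; apply: (@cvgM R _ (nbhs x) _ (fun=> a j) (fun y : 'rV[R]_m => y 0 j)).
    exact: cvg_cst.
  exact: coord_continuous.
elim: (index_enum _) => [|j r IHr] x.
  by under eq_fun do rewrite big_nil; exact: cst_continuous.
under eq_fun do rewrite big_cons.
exact: (@cvgD _ _ _ (nbhs x) _ _ _ _ _ (C j x) (IHr x)).
Qed.

Section LimitPoint.
Context (R : realType) {n : nat} (p : nat -> 'I_n.+1) (b : nat -> nat).
Local Notation e := (level p b).
Local Notation X := (lattice_basis R p b).
Local Notation U := (dual_basis R p b).
Local Notation W := (weight p b).
Local Notation rest := (rest p b).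

Context (b_homo : {homo b : s t / (s <= t)%N}).

Lemma dual_mover_sum_gt0 s : 0 < \sum_j U s (p s) j.
Proof. by apply: lt_le_trans (dual_sum_ge _ _ _ b_homo s); rewrite exprn_gt0. Qed.

(** The dual vectors of the movers, scaled to coordinate sum 1, lie in a compact cube, and xi is a
    cluster point. From stage [s] on they lie in the cone of stage [s], and all the conditions are
    closed. *)
Lemma limit_point_exists : exists xi : 'rV[R]_n.+1,
  (forall s i, 0 <= dot (row i (X s)) xi) /\ \sum_j xi 0 j = 1.
Proof.
pose v s : 'rV[R]_n.+1 := (\sum_j U s (p s) j)^-1 *: row (p s) (U s).
have vE s j : v s 0 j = (\sum_j U s (p s) j)^-1 * U s (p s) j by rewrite !mxE.
have v1 s : \sum_j v s 0 j = 1.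
  under eq_bigr do rewrite vE.
  by rewrite -mulr_sumr mulVf // gt_eqF // dual_mover_sum_gt0.
have v0 s j : 0 <= v s 0 j.
  by rewrite vE mulr_ge0 ?invr_ge0 ?(ltW (dual_mover_sum_gt0 s)) ?dual_basis_ge0.
pose K : set 'rV[R]_n.+1 := [set x | forall j, `[0 : R, 1]%classic (x 0 j)].
have cK : compact K.
  apply: (@rV_compact _ _ (fun=> `[0 : R, 1]%classic)) => _.
  exact: segment_compact.
have KF : (v @ \oo) K.
  exists 0%N => // s _ j /=; rewrite in_itv /= v0 -(v1 s) (bigD1 j) //= lerDl.
  by apply: sumr_ge0.
have [xi [_ clxi]] := cK (v @ \oo) _ KF.
have inC (A : set R) a s : closed A ->
    (forall t, (s <= t)%N -> A (\sum_j a j * v t 0 j)) -> A (\sum_j a j * xi 0 j).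
  move=> cA tA.
  have cl : closed [set x : 'rV[R]_n.+1 | A (\sum_j a j * x 0 j)].
    by apply: (closed_comp _ cA) => x _; exact: linear_form_continuous.
  apply: cl => B nB; have FA : (v @ \oo) [set x | A (\sum_j a j * x 0 j)].
    by exists s.
  by have [y [Ay By]] := clxi _ _ FA nB; exists y.
exists xi; split=> [s i|].
  have := inC [set y | 0 <= y] (fun j => X s i j) s (closed_ge (y := 0)).
  have -> : dot (row i (X s)) xi = \sum_j X s i j * xi 0 j.
    by apply: eq_bigr => j _; rewrite mxE.
  apply=> t st /=; under eq_bigr do rewrite vE mulrCA.
  rewrite -mulr_sumr mulr_ge0 ?invr_ge0 ?(ltW (dual_mover_sum_gt0 t)) //.
  have := basis_mul_dual_ge0 R p b s (t - s) i (p t); rewrite subnKC // mxE.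
  by under eq_bigr do rewrite mxE.
have := inC [set y | y = 1] (fun j => 1) 0%N (closed_eq (y := 1)).
rewrite /=; under eq_bigr do rewrite mul1r.
by apply=> t _; under eq_bigr do rewrite mul1r.
Qed.

End LimitPoint.

(** * Successive minima and rational independence *)

Section Minima.
Context (R : realType) {n : nat} (p : nat -> 'I_n.+1) (b : nat -> nat).
Local Notation e := (level p b).
Local Notation X := (lattice_basis R p b).
Local Notation U := (dual_basis R p b).
Local Notation W := (weight p b).
Local Notation rest := (rest p b).

Context (b_homo : {homo b : s t / (s <= t)%N}).
Context (gap : forall s, p s.+1 != p s -> (e s (p s) + s + 2 <= b s)%N).
Context (recurrent : forall i s, exists2 t, (s <= t)%N & p t = i).
Context (xi : 'rV[R]_n.+1) (xi_cone : forall s i, 0 <= dot (row i (X s)) xi).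
Context (xi_ge1 : 1 <= \sum_j xi 0 j) (xi_le2 : \sum_j xi 0 j <= 2).

Local Notation c s i := (dot (row i (X s)) xi).

Lemma cone_expansion s j : xi 0 j = \sum_i c s i * U s i j.
Proof.
have -> : xi 0 j = (xi *m 1%:M) 0 j by rewrite mulmx1.
rewrite -(trmx1 R n.+1) -(dual_basisK R p b s) trmx_mul trmxK mulmxA mxE.
apply: eq_bigr => i _; congr (_ * _); rewrite mxE /dot.
by apply: eq_bigr => l _; rewrite !mxE mulrC.
Qed.

(** In the expansion of the coordinate sum of xi along the dual basis all terms are nonnegative, so
    the mover's term alone is at most 2. *)
Lemma mover_form_le s : c s (p s) * 2 ^+ rest s <= 2.
Proof.
apply: le_trans xi_le2; under eq_bigr do rewrite (cone_expansion s).
rewrite exchange_big (bigD1 (p s)) //= -mulr_sumr.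
apply: le_trans (_ : c s (p s) * \sum_j U s (p s) j <= _).
  by rewrite ler_wpM2l // dual_sum_ge.
rewrite lerDl sumr_ge0 // => i _; apply: sumr_ge0 => j _.
by rewrite mulr_ge0 ?dual_basis_ge0.
Qed.

Lemma row_basisS s i : i != p s -> row i (X s.+1) = row i (X s).
Proof.
move=> ip; apply/rowP => j; rewrite mxE [RHS]mxE basisS (negbTE ip).
by rewrite !mul0r subr0.
Qed.

(** Until [i] next becomes the mover, its vector and its level do not change while the weight can
    only grow; at that time [mover_form_le] applies. *)
Lemma form_le s i : c s i * 2 ^+ W s <= 2 * 2 ^+ e s i.
Proof.
have [t st pt] := recurrent i s; rewrite -(subnKC st) in pt.
move: (t - s)%N pt => d {t st}; elim: d s => [|d IHd] s; rewrite ?addn0 => pt.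
  rewrite weight_rest -pt exprD mulrCA mulrC ler_pM2r ?exprn_gt0 //.
  exact: mover_form_le.
have [ip|ip] := eqVneq i (p s).
  rewrite weight_rest -ip exprD mulrCA mulrC ler_pM2r ?exprn_gt0 // ip.
  exact: mover_form_le.
rewrite -addSnnS in pt; have := IHd _ pt.
rewrite row_basisS // levelS_other //; apply: le_trans.
by rewrite ler_wpM2l // ler_weXn2l ?ler1n // weight_homo.
Qed.

(* The trajectory value exp (L_x q), Q = exp q, of the i-th basis vector x of
   stage s, up to bounded factors and for 2 ^ W s <= Q <= 2 ^ W s.+1. *)
Definition size_at (s : nat) (Q : R) (i : 'I_n.+1) : R :=
  if i == p s then Q / 2 ^+ rest s else 2 ^+ e s i.

Lemma prod_size_at s Q : \prod_i size_at s Q i = Q.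
Proof.
rewrite (bigD1 (p s)) //= /size_at eqxx.
rewrite (eq_bigr (fun i => 2 ^+ e s i)); last by move=> i /negbTE ->.
by rewrite prodrXr divfK // expf_neq0.
Qed.

Section Stage.
Context (s : nat) (Q : R) (Q_ge : 2 ^+ W s <= Q) (Q_le : Q <= 2 ^+ W s.+1).

Let Q_gt0 : 0 < Q.
Proof. by apply: lt_le_trans Q_ge; rewrite exprn_gt0. Qed.

Lemma size_at_gt0 i : 0 < size_at s Q i.
Proof. by rewrite /size_at; case: ifP => _; rewrite ?divr_gt0 ?exprn_gt0. Qed.

Lemma size_at_ge i : 2 ^+ e s i <= size_at s Q i.
Proof.
rewrite /size_at; case: eqP => // ->; rewrite ler_pdivlMr ?exprn_gt0 //.
by rewrite -exprD -weight_rest.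
Qed.

Lemma size_at_le i : size_at s Q i <= 2 ^+ e s.+1 i.
Proof.
rewrite /size_at; case: (eqVneq i (p s)) => [->|ip]; last by rewrite levelS_other.
by rewrite /= eqxx ler_pdivrMr ?exprn_gt0 // -exprD -weightS.
Qed.

Lemma enorm_basis_le i : enorm (row i (X s)) <= 2 * size_at s Q i.
Proof.
apply: le_trans (enorm_le_sum _) _; under eq_bigr do rewrite mxE.
apply: le_trans (basis_norm_le R p b b_homo gap s i) _.
apply: ler_pM; rewrite ?exprn_ge0 ?size_at_ge //.
  by rewrite subr_ge0; apply: (@le_trans _ _ 1); [apply: exprn_ile1; lra|lra].
by rewrite gerBl exprn_ge0 // invr_ge0.
Qed.

Lemma form_basis_le i : `|c s i| <= 2 * size_at s Q i / Q.
Proof.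
rewrite ger0_norm // ler_pdivlMr // /size_at; case: (eqVneq i (p s)) => [->|ip].
  rewrite mulrA ler_pdivlMr ?exprn_gt0 // mulrAC ler_pM2r //.
  exact: mover_form_le.
(* This vector survives the step, so the bound of stage [s.+1] applies, where 2^(W s.+1) >= Q. *)
have := form_le s.+1 i; rewrite row_basisS // levelS_other //.
by apply: le_trans; rewrite ler_wpM2l.
Qed.

(** The first two factors come from [int_det_lower], the power of 2 from the bounds on the n basis
    vectors kept in [lattice_vector_ge]. *)
Definition minima_const : R := n.+1%:R * n.+1`!%:R * 2 ^+ n.

Lemma minima_const_gt0 : 0 < minima_const.
Proof. by rewrite !mulr_gt0 ?exprn_gt0 ?ltr0n ?fact_gt0. Qed.

(** Putting [v] in the place of the basis vector [i] keeps the determinant nonzero, so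
    [int_det_lower] bounds Q by a constant times l times the other sizes. Since all sizes multiply
    to Q, the other ones cancel. *)
Lemma lattice_vector_ge v l i : int_lattice v -> enorm v <= l ->
    `|dot v xi| <= l / Q -> (v *m (U s)^T) 0 i != 0 ->
  size_at s Q i <= minima_const * l.
Proof.
move=> iv nv dv vi; pose A := \matrix_(h, j) if h == i then v 0 j else X s h j.
have rA h : row h A = if h == i then v else row h (X s).
  by apply/rowP => j; rewrite !mxE; case: ifP => _; rewrite ?mxE.
have adjE : \adj (X s) = \det (X s) *: (U s)^T.
  rewrite -[LHS]mulmx1 -(basis_dualK R p b s) mulmxA mul_adj_mx.
  by rewrite mul_scalar_mx.
have dX : \det (X s) != 0.
  have : \det (X s *m (U s)^T) != 0 by rewrite basis_dualK det1 oner_eq0.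
  by rewrite det_mulmx mulf_eq0 negb_or => /andP[].
have dA : \det A != 0.
  by rewrite det_replace_row adjE -scalemxAr mxE mulf_neq0.
have := @int_det_lower R n.+1 A
  (fun h => if h == i then l else 2 * size_at s Q h) xi Q.
have H : [/\ forall h j, A h j \is a Num.int,
    forall h, enorm (row h A) <= (if h == i then l else 2 * size_at s Q h) &
    forall h, `|dot (row h A) xi| <= (if h == i then l else 2 * size_at s Q h) / Q].
  split=> h; last 2 first.
  - by rewrite rA; case: eqP => // _; exact: enorm_basis_le.
  - by rewrite rA; case: eqP => // _; exact: form_basis_le.
  - by move=> j; rewrite mxE; case: ifP => // _; exact: lattice_basis_int.
case: H => H1 H2 H3 /(_ H1 dA Q_gt0 H2 H3 xi_ge1).
rewrite (bigD1 i) //= eqxx.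
rewrite (eq_bigr (fun h => 2 * size_at s Q h)); last by move=> h /negbTE ->.
rewrite big_split /= prodr_const cardC1 card_ord /=.
rewrite -{1}(prod_size_at s Q) (bigD1 i) //=.
have P0 : 0 < \prod_(h | h != i) size_at s Q h.
  by apply: prodr_gt0 => h _; exact: size_at_gt0.
have -> : n.+1%:R * n.+1`!%:R * (l * (2 ^+ n * \prod_(h | h != i) size_at s Q h))
  = minima_const * l * \prod_(h | h != i) size_at s Q h.
  by rewrite /minima_const; ring.
by rewrite ler_pM2r.
Qed.

Local Notation lambda j := (successive_minimum (convex_body xi Q) int_lattice j).

Lemma candidate_basis j (f : 'I_j -> 'I_n.+1) M : injective f -> 0 < M ->
    (forall h, size_at s Q (f h) <= M) ->
  minimum_candidates (convex_body xi Q) int_lattice j (2 * M).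
Proof.
move=> f_inj M0 fM; split; first by rewrite mulr_ge0 // ltW.
exists (rowsub f (X s)); split.
  apply/row_freeP; exists (colsub f (U s)^T).
  apply/matrixP => h h'.
  have := congr1 (fun A : 'M[R]_n.+1 => A (f h) (f h')) (basis_dualK R p b s).
  rewrite !mxE (inj_eq f_inj) => <-.
  by apply: eq_bigr => l _; rewrite !mxE.
move=> h; have -> : row h (rowsub f (X s)) = row (f h) (X s).
  by apply/rowP => l; rewrite !mxE.
split; last by move=> l; rewrite mxE; exact: lattice_basis_int.
apply/dilate_convex_bodyP; first by rewrite mulr_gt0.
split; first by apply: le_trans (enorm_basis_le _) _; rewrite ler_pM2l.
apply: le_trans (form_basis_le _) _; rewrite ler_pM2r ?invr_gt0 //.
by rewrite ler_pM2l.
Qed.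

Lemma minimum_le j (f : 'I_j -> 'I_n.+1) M : injective f -> 0 < M ->
  (forall h, size_at s Q (f h) <= M) -> lambda j <= 2 * M.
Proof.
move=> f_inj M0 fM; apply: ge_inf; last exact: candidate_basis fM.
by exists 0 => x [].
Qed.

(** Lower bounds for the candidates pass to the infimum only when there is a candidate. *)
Lemma candidates_nonempty j : (j <= n.+1)%N ->
  minimum_candidates (convex_body xi Q) int_lattice j !=set0.
Proof.
move=> jn; pose M := 1 + \sum_i size_at s Q i.
have size_ge0 i : 0 <= size_at s Q i by exact/ltW/size_at_gt0.
have M0 : 0 < M by rewrite ltr_pwDl // sumr_ge0.
exists (2 * M); apply: (@candidate_basis j (widen_ord jn)) => //.
  by move=> i i' /(congr1 val) /= ii'; exact: val_inj.
move=> h; rewrite /M (bigD1 (widen_ord jn h)) //= addrCA lerDl.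
by rewrite addr_ge0 // sumr_ge0.
Qed.

Lemma candidate_ge1 j l : (0 < j)%N ->
  minimum_candidates (convex_body xi Q) int_lattice j l -> 1 <= l.
Proof.
case: j => // j _ [l0 [M [fM MP]]]; have [[x [nx _] xE] iM] := MP ord0.
apply: (@le_trans _ _ (enorm (row ord0 M))).
  apply: enorm_ge1 => //; apply/eqP => M0.
  move/row_freeP: fM => [B MB].
  have := congr1 (row ord0) MB; rewrite row_mul M0 mul0mx => /rowP/(_ ord0).
  by rewrite !mxE => /eqP; rewrite eq_sym oner_eq0.
by rewrite -xE enormZ // ler_piMr.
Qed.

Lemma minimum_ge1 j : (0 < j <= n.+1)%N -> 1 <= lambda j.
Proof.
move=> /andP[j0 jn]; apply: lb_le_inf; first exact: candidates_nonempty.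
by move=> l; exact: candidate_ge1.
Qed.

(** Independence forces one of the [k.+1] vectors out of the span of the first [k] basis vectors;
    its nonzero coordinate at some [i >= k] feeds [lattice_vector_ge]. *)
Lemma minimum_ge k M : (k <= n)%N ->
    (forall i : 'I_n.+1, (k <= i)%N -> M <= size_at s Q i) ->
  M / minima_const <= lambda k.+1.
Proof.
move=> kn kM; apply: lb_le_inf; first exact: candidates_nonempty.
move=> l cl; have l1 := candidate_ge1 k.+1 l isT cl; case: cl => _ [A [fA AP]].
have l0 : 0 < l by exact: lt_le_trans l1.
have [r [i [ki Ai]]] : exists r (i : 'I_n.+1), (k <= i)%N /\
    (row r A *m (U s)^T) 0 i != 0.
  apply: contrapT => H.
  have AE : A *m (U s)^T = A *m (U s)^T *m pid_mx k.
    apply/matrixP => r i; rewrite [RHS]mxE (bigD1 i) //= big1 ?addr0 => [|h hi].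
      rewrite mxE [(pid_mx _ : 'M[R]__) _ _]mxE eqxx /=.
      case: ltnP => [_|ki]; first by rewrite mulr1.
      rewrite mulr0; apply: contrapT => /eqP H'; apply: H; exists r, i; split=> //.
      by rewrite -row_mul mxE mxE.
    have hi' : (nat_of_ord h == nat_of_ord i) = false by apply: negbTE.
    by rewrite [(pid_mx _ : 'M[R]__) _ _]mxE hi' mulr0.
  have : (\rank A <= k)%N.
    have -> : A = A *m (U s)^T *m X s by rewrite -mulmxA dual_basisK mulmx1.
    apply: leq_trans (mxrankM_maxl _ _) _; rewrite AE.
    by apply: leq_trans (mxrankM_maxr _ _) _; rewrite rank_pid_mx // leqW.
  by move: fA; rewrite /row_free => /eqP ->; rewrite ltnn.
have [/(dilate_convex_bodyP xi Q l _ l0) [nr dr] ir] := AP r.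
rewrite ler_pdivrMr ?minima_const_gt0 // mulrC.
apply: le_trans (kM i ki) _; exact: lattice_vector_ge ir nr dr Ai.
Qed.

End Stage.

Context (b_ge : forall s, (s <= b s)%N).

Lemma levels_unbounded M : exists s, forall i, (M <= e s i)%N.
Proof.
have /fin_all_exists[t tP] i : exists t, (M <= t)%N /\ p t = i.
  by have [t Mt pt] := recurrent i M; exists t.
exists (\max_i t i).+1 => i; have [Mt pt] := tP i.
apply: leq_trans (leq_trans Mt (b_ge _)) _.
by apply: target_le_level => //; rewrite ltnS leq_bigmax.
Qed.

(** Clearing denominators in a relation gives a nonzero integer vector orthogonal to xi. By
    [lattice_vector_ge] its fixed norm would bound some level at every stage, whereas all levels
    tend to infinity. *)
Lemma limit_point_rat_independent : rat_independent xi.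
Proof.
move=> a a0; apply: contrapT => /existsNP[i0 /eqP ai0].
pose N : int := \prod_i denq (a i).
have N0 : N != 0 by apply/prodf_neq0 => i _; rewrite denq_neq0.
pose v : 'rV[R]_n.+1 := \row_i (ratr (a i) * N%:~R).
have iv : int_lattice v.
  move=> i; rewrite mxE /N (bigD1 i) //= intrM mulrA.
  have -> : ratr (a i) * (denq (a i))%:~R = (numq (a i))%:~R :> R.
    by rewrite /ratr divfK // intr_eq0 denq_neq0.
  by rewrite rpredM ?rpred_int.
have vxi : dot v xi = 0.
  rewrite /dot; under eq_bigr do rewrite mxE mulrAC.
  by rewrite -mulr_suml a0 mul0r.
have v0 : v != 0.
  apply/rV0Pn; exists i0; rewrite mxE mulf_neq0 ?fmorph_eq0 // ?intr_eq0 //.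
pose B := minima_const * enorm v.
have [s sP] := levels_unbounded (Num.truncn B).+1.
have [i vi] : exists i, (v *m (U s)^T) 0 i != 0.
  apply/rV0Pn/eqP => vU; move/eqP: v0; apply.
  by rewrite -[v]mulmx1 -(dual_basisK R p b s) mulmxA vU mul0mx.
have WW : 2 ^+ W s <= 2 ^+ W s.+1 :> R.
  by rewrite ler_weXn2l ?ler1n ?weight_homo.
have dv : `|dot v xi| <= enorm v / 2 ^+ W s.
  by rewrite vxi normr0 divr_ge0 ?exprn_ge0 ?sqrtr_ge0.
have := lattice_vector_ge s _ (lexx _) WW v _ i iv (lexx _) dv vi.
apply/negP; rewrite -ltNge; apply: lt_le_trans (size_at_ge s _ (lexx _) i).
apply: lt_le_trans (_ : (Num.truncn B).+1%:R <= _); first exact: truncnS_gt.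
apply: (@le_trans _ _ (e s i)%:R); first by rewrite ler_nat.
by rewrite -natrX ler_nat ltnW // ltn_expl.
Qed.

End Minima.

(** * Real asymptotics *)

Section Asymptotics.
Context {R : realType}.

(** Both bounds come from 1 + x <= exp x, at x = -1/2 and x = 1. *)
Lemma ln2_bounds : 2^-1 <= ln (2 : R) <= 1.
Proof.
have e1 : expR (2^-1) <= 2 :> R.
  have := expR_ge1Dx (- (2^-1) : R); rewrite expRN.
  have := expR_gt0 (2^-1 : R) => e0 h.
  have : (1 - 2^-1) * expR (2^-1) <= 1 :> R by rewrite -ler_pdivlMr // div1r.
  lra.
apply/andP; split.
  by rewrite -(expRK 2^-1) ler_ln ?posrE ?expR_gt0.
rewrite -[leRHS](expRK 1) ler_ln ?posrE ?expR_gt0 //.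
by have := expR_ge1Dx (1 : R); lra.
Qed.

Lemma sqrt_little_o (K eps : R) : 0 < K -> 0 < eps ->
  exists M : R, 0 < M /\ forall q, M < q -> K * (Num.sqrt q + 1) <= eps * q.
Proof.
(* For r = sqrt q >= r0 one has K (r + 1) <= 2 K r <= eps r^2. *)
move=> K0 eps0; pose r0 := Num.max 1 (2 * K / eps).
have r1 : 1 <= r0 by rewrite le_max lexx.
have r2 : 2 * K / eps <= r0 by rewrite le_max lexx orbT.
have r0_gt0 : 0 < r0 by lra.
exists (r0 ^+ 2); split=> [|q qM]; first by rewrite exprn_gt0.
have q0 : 0 <= q by apply: ltW; apply: le_lt_trans qM; rewrite sqr_ge0.
have sq : r0 <= Num.sqrt q.
  by rewrite -(ger0_norm (ltW r0_gt0)) -sqrtr_sqr ler_sqrt // ltW.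
rewrite -{2}(sqr_sqrtr q0); move: (Num.sqrt q) sq => r rr0.
have : 2 * K / eps <= r by lra.
rewrite ler_pdivrMr // => H; nra.
Qed.

Lemma limf_einf_pinfty (f : R -> R) (l : R) :
    (forall eps, 0 < eps -> exists M, forall q, M < q -> l - eps <= f q) ->
    (forall eps, 0 < eps -> forall M, exists2 q, M < q & f q <= l + eps) ->
  limf_einf (fun q => (f q)%:E) (pinfty_nbhs R) = l%:E.
Proof.
move=> lb ub; rewrite limf_einfE; apply/eqP; rewrite eq_le; apply/andP; split.
  apply: ge_ereal_sup => _ [A [M [_ MA]] <-].
  apply/lee_addgt0Pr => eps eps0; have [q Mq fq] := ub _ eps0 M.
  apply: (@le_trans _ _ (f q)%:E); last by rewrite -EFinD lee_fin.
  by apply: ereal_inf_lbound; exists q => //; exact: MA.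
apply/lee_subgt0Pr => eps eps0; have [M MP] := lb _ eps0.
apply: (@le_trans _ _ (ereal_inf ((fun q => (f q)%:E) @` [set q | M < q]))).
  apply: le_ereal_inf_tmp => _ [q Mq <-].
  by rewrite -EFinB lee_fin; exact: MP.
apply: ereal_sup_ubound; exists [set q | M < q] => //.
by exists M; split=> //; exact: num_real.
Qed.

End Asymptotics.

(** * Asymptotics of the logarithmic minima *)

Section Construction.
Context (R : realType) (n k : nat).
Hypotheses (k_gt1 : (1 < k)%N) (le_kn : (k <= n)%N).
Local Notation D := (n - k + 2)%N.
Local Notation p := (mover n k).
Local Notation b := (target n k).
Local Notation e := (level p b).
Local Notation W := (weight p b).

Let b_homo := target_homo n k.
Let gap := level_gap n k k_gt1 le_kn.
Let recurrent := mover_recurrent n k k_gt1 le_kn.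

Lemma leq_target s : (s <= b s)%N.
Proof.
rewrite /target /height; have := cycle_bounds n k s; set t := (s %/ D)%N; nia.
Qed.

Lemma leq_height t : (t <= height n k t)%N.
Proof. rewrite /height; nia. Qed.

Lemma stage_exists (x : R) : 1 <= x ->
  exists s, 2 ^+ W s <= x /\ x <= 2 ^+ W s.+1.
Proof.
move=> x1; have ex : exists s, x <= 2 ^+ W s.+1.
  exists ((Num.truncn x).+1 * D)%N.
  apply: (@le_trans _ _ (Num.truncn x).+1%:R); first exact: ltW (truncnS_gt x).
  apply: (@le_trans _ _ (2 ^+ W ((Num.truncn x).+1 * D))); last first.
    by rewrite ler_weXn2l ?ler1n // weight_homo.
  rewrite -natrX ler_nat; apply: leq_trans (ltnW (ltn_expl _ (isT : 1 < 2)%N)) _.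
  rewrite leq_exp2l //; apply: leq_trans (leq_height _) _.
  have := height_le_weight n k k_gt1 le_kn ((Num.truncn x).+1 * D).
  by rewrite mulnK ?addn2.
(* At stage 0 the weight is 0 and 1 <= x suffices; later the lower bound is the minimality of the
   stage. *)
case: (ex_minnP ex) => [[|s]] sP smin; [exists 0%N|exists s.+1]; split=> //.
  by rewrite /weight big1.
rewrite leNgt; apply/negP => xs; suff : (s < s)%N by rewrite ltnn.
by apply: smin; exact: ltW.
Qed.

Context (xi : 'rV[R]_n.+1).
Hypothesis xi_cone : forall s i, 0 <= dot (row i (lattice_basis R p b s)) xi.
Hypotheses (xi_ge1 : 1 <= \sum_j xi 0 j) (xi_le2 : \sum_j xi 0 j <= 2).

Let ln_pow2 m : ln (2 ^+ m) = m%:R * ln (2 : R).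
Proof. by rewrite lnXn // mulr_natl. Qed.

(** The [k - 1] positions below [k] other than the exceptional one, enumerated by [lift], all have
    small level; the summand 1 is the factor 2 of [minimum_le]. *)
Lemma log_minimum_small (q : R) s : 2 ^+ W s <= expR q -> expR q <= 2 ^+ W s.+1 ->
  0 <= log_minimum xi k.-1 q <= (4 * D.+1 * (s %/ D) + 1)%:R * ln 2.
Proof.
move=> Ws WS.
have l1 : 1 <= successive_minimum (convex_body xi (expR q)) int_lattice k.-1.
  by apply: minimum_ge1 Ws WS _ _ => //; lia.
rewrite /log_minimum ln_ge0 // -ln_pow2 ler_ln ?posrE ?exprn_gt0 //; last first.
  exact: lt_le_trans l1.
pose z := (loglog (s %/ D) %% k)%N.
have zk : (z < k)%N by rewrite ltn_mod ltnW.
have lekn : (k <= n.+1)%N by lia.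
rewrite addn1 exprS.
apply: (minimum_le R p b _ _ _ _ _ _ s _ Ws WS _
  (fun h => widen_ord lekn (lift (Ordinal zk) h))) => //.
- move=> h h' /(congr1 val) /= hh'; apply: (@lift_inj _ (Ordinal zk)).
  exact: val_inj.
move=> h; apply: le_trans (size_at_le R p b s _ WS _) _.
rewrite ler_weXn2l ?ler1n //; apply: small_level => //.
  exact: (ltn_ord (lift (Ordinal zk) h)).
by move=> E; have /eqP[] := neq_lift (Ordinal zk) h; exact/val_inj/esym.
Qed.

Lemma log_minimum_large (q : R) s : 2 ^+ W s <= expR q -> expR q <= 2 ^+ W s.+1 ->
  (height n k (s %/ D))%:R * ln 2 - ln (minima_const R (n := n)) <=
    log_minimum xi k.+1 q.
Proof.
move=> Ws WS; have c0 := @minima_const_gt0 R n.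
rewrite -ln_pow2 -ln_div ?posrE ?exprn_gt0 // /log_minimum.
have H : 2 ^+ height n k (s %/ D) / minima_const R (n := n) <=
    successive_minimum (convex_body xi (expR q)) int_lattice k.+1.
  apply: (minimum_ge R p b _ _ _ _ _ _ _ s _ Ws WS) => // i ki.
  apply: le_trans (size_at_ge R p b s _ Ws i).
  by rewrite ler_weXn2l ?ler1n // height_le_level.
rewrite ler_ln ?posrE ?divr_gt0 ?exprn_gt0 //.
by rewrite (lt_le_trans _ H) ?divr_gt0 ?exprn_gt0.
Qed.

(** If the stage of q lies in cycle t, then [height_le_weight] gives t^2 <= q, and [weight_le]
    bounds q by D ln 2 times the height at t+1, up to O(t). Going from the height at t+1 to that at
    t costs O(t) as well, hence O(sqrt q). *)
Lemma log_minimum_asymptotics : exists K : R, [/\ 0 < K,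
  forall q, 0 <= q -> 0 <= log_minimum xi k.-1 q <= K * (Num.sqrt q + 1),
  forall q, 0 <= q -> q / D%:R - K * (Num.sqrt q + 1) <= log_minimum xi k.+1 q &
  forall M, exists2 q, M < q & log_minimum xi k.+1 q <= q / D%:R + K].
Proof.
have /andP[l_ge l_le] := @ln2_bounds R; have l0 : 0 < ln (2 : R) by lra.
pose d : R := D%:R; have d2 : 2 <= d by rewrite ler_nat; lia.
(* The coefficient of the linear term in [weight_le]. *)
pose A : R := 4 * n.+1%:R * (d + 1).
have n1 : 1 <= n.+1%:R :> R by rewrite ler1n.
have A0 : 4 * (d + 1) <= A.
  by rewrite /A -mulrA ler_pM2l // ler_peMl //; lra.
pose lc : R := ln (minima_const R (n := n)).
have lc0 := ler_norm lc; have lc1 := normr_ge0 lc.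
have heightE t : (height n k t)%:R = (d + 1) * t%:R ^+ 2 :> R.
  by rewrite /height natrM natrX -natr1.
pose K := A + 2 * (d + 1) + `|lc| + 1.
have stageP (q : R) : 0 <= q -> exists s, [/\ 2 ^+ W s <= expR q,
    expR q <= 2 ^+ W s.+1, (s %/ D)%:R <= Num.sqrt q &
    q <= ln 2 * (A * (s %/ D)%:R + d * ((d + 1) * ((s %/ D)%:R + 1) ^+ 2))].
  move=> q0; have [|s [Ws WS]] := stage_exists (expR q).
    by rewrite -[leLHS]expR0 ler_expR.
  exists s; split=> //.
    have t0 : 0 <= (s %/ D)%:R :> R by [].
    rewrite -(ger0_norm t0) -sqrtr_sqr ler_sqrt //.
    have : (W s)%:R * ln 2 <= q.
      by rewrite -ln_pow2 -[leRHS]expRK ler_ln ?posrE ?exprn_gt0 ?expR_gt0.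
    apply: le_trans.
    have : (height n k (s %/ D))%:R <= (W s)%:R :> R.
      by rewrite ler_nat height_le_weight.
    rewrite heightE => H; have := ler_wpM2r (ltW l0) H; apply: le_trans.
    have t20 : 0 <= (s %/ D)%:R ^+ 2 :> R by rewrite sqr_ge0.
    rewrite -mulrA mulrCA ler_peMr //; nra.
  have : q <= (W s.+1)%:R * ln 2.
    by rewrite -ln_pow2 -[leLHS]expRK ler_ln ?posrE ?exprn_gt0 ?expR_gt0.
  move/le_trans; apply; rewrite mulrC ler_pM2l //.
  have := weight_le n k k_gt1 le_kn s; rewrite -(ler_nat R).
  move/le_trans; apply; rewrite natrD [(D * height _ _ _)%:R]natrM heightE.
  rewrite !natrM -[D.+1%:R]natr1 -[(s %/ D).+1%:R]natr1 -/d le_eqVlt.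
  by apply/orP; left; apply/eqP; rewrite /A; ring.
exists K; split.
- by rewrite /K; lra.
- move=> q q0; have [s [Ws WS tq _]] := stageP q q0.
  have /andP[-> /le_trans->//] := log_minimum_small q s Ws WS.
  have t0 : 0 <= (s %/ D)%:R :> R by [].
  rewrite natrD !natrM -[D.+1%:R]natr1 -/d.
  move: (Num.sqrt q) ((s %/ D)%:R) tq t0 => r t tr t0.
  apply: (@le_trans _ _ ((4 * (d + 1) * t + 1) * 1)).
    by rewrite ler_wpM2l //; nra.
  have : 4 * (d + 1) * t <= A * r by apply: ler_pM => //; lra.
  by rewrite /K; nra.
- move=> q q0; have [s [Ws WS tq qle]] := stageP q q0.
  apply: le_trans (log_minimum_large q s Ws WS); rewrite heightE -/lc.
  have t0 : 0 <= (s %/ D)%:R :> R by [].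
  move: (Num.sqrt q) ((s %/ D)%:R) tq t0 qle => r t tr t0 qle.
  have : q / d <= ln 2 * (A * t + (d + 1) * (t + 1) ^+ 2).
    rewrite ler_pdivrMr; last lra.
    apply: le_trans qle _; rewrite -[leRHS]mulrA ler_pM2l //.
    have : 0 <= (d - 1) * (A * t) by rewrite !mulr_ge0 //; lra.
    lra.
  have : ln 2 * (A * t + (d + 1) * (2 * t + 1)) <=
      1 * (A * t + (d + 1) * (2 * t + 1)).
    by rewrite ler_wpM2r //; nra.
  have : A * t <= A * r by rewrite ler_wpM2l //; lra.
  have : (d + 1) * t <= (d + 1) * r by rewrite ler_wpM2l //; lra.
  have : 0 <= `|lc| * r by rewrite mulr_ge0 //; lra.
  by rewrite /K -/d; nra.
(* At q = W s ln 2 stage [s] just begins, so every size, the mover's included, equals 2^level and is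
   at most 2^height, while W s is at least D times that height. The factor 2 before [|M|] makes up
   for ln 2 >= 1/2. *)
- move=> M; have [s [t [Mt eh Wh]]] :=
    saturated n k k_gt1 le_kn (Num.truncn (2 * `|M|)).+1.
  pose q : R := (W s)%:R * ln 2.
  have Eq : expR q = 2 ^+ W s by rewrite /q -ln_pow2 lnK // posrE exprn_gt0.
  have hW : d * (height n k t.+1)%:R <= (W s)%:R by rewrite -natrM ler_nat.
  have h0 : 0 <= (height n k t.+1)%:R :> R by [].
  exists q.
    apply: le_lt_trans (ler_norm M) _.
    have : (2 * `|M|) < (Num.truncn (2 * `|M|)).+1%:R by exact: truncnS_gt.
    have : (Num.truncn (2 * `|M|)).+1%:R <= (height n k t.+1)%:R :> R.
      by rewrite ler_nat (leq_trans Mt) // (leq_trans (leqnSn t)) // leq_height.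
    move=> H1 H2; have H3 : 2 * `|M| < (W s)%:R by nra.
    have : (W s)%:R * 2^-1 <= (W s)%:R * ln 2 :> R by rewrite ler_wpM2l.
    by rewrite /q; lra.
  have Ws : 2 ^+ W s <= expR q by rewrite Eq.
  have WS : expR q <= 2 ^+ W s.+1.
    by rewrite Eq ler_weXn2l ?ler1n // weight_homo.
  have l1 : 1 <= successive_minimum (convex_body xi (expR q)) int_lattice k.+1.
    by apply: minimum_ge1 Ws WS _ _ => //; lia.
  have lek : (k.+1 <= n.+1)%N by [].
  have H : successive_minimum (convex_body xi (expR q)) int_lattice k.+1 <=
      2 ^+ (height n k t.+1).+1.
    rewrite exprS.
    apply: (minimum_le R p b _ _ _ _ _ _ s _ Ws WS _ (widen_ord lek)) => //.
      by move=> h h' /(congr1 val) /= hh'; exact: val_inj.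
    move=> h; rewrite /size_at Eq weight_rest exprD.
    case: eqP => _; last by rewrite ler_weXn2l ?ler1n.
    by rewrite mulfK ?expf_neq0 // ler_weXn2l ?ler1n.
  have : log_minimum xi k.+1 q <= (height n k t.+1).+1%:R * ln 2.
    rewrite -ln_pow2 /log_minimum ler_ln ?posrE ?exprn_gt0 //.
    exact: lt_le_trans l1.
  move/le_trans; apply.
  have : (height n k t.+1)%:R * ln 2 <= q / d.
    by rewrite ler_pdivlMr /q; [rewrite mulrAC ler_pM2r // mulrC|lra].
  by rewrite -(natr1 (height n k t.+1)) mulrDl mul1r /K -/d; lra.
Qed.

End Construction.

(** * Uncountably many vectors *)

Lemma uncountable_segment (R : realType) : ~ countable `[1 : R, 2]%classic.
Proof.
move=> /countable_lebesgue_measure0.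
by rewrite lebesgue_measure_itv /= lte_fin ltr1n /= -EFinB => -[]; lra.
Qed.

Theorem theorem2 (R : realType) (n k : nat)
    (hn : (2 <= n)%N) (hk2 : (2 <= k)%N) (hkn : (k <= n)%N) :
  ~ countable
      [set xi : 'rV[R]_n.+1 |
        [/\ rat_independent xi,
            log_minimum xi k.-1 q / q @[q --> +oo] --> (0 : R) &
            limf_einf (fun q : R => (log_minimum xi k.+1 q / q)%:E)
                      (pinfty_nbhs R)
              = ((n - k + 2)%:R^-1)%:E]].
Proof.
set S := [set xi | _] => cS.
have b_homo := target_homo n k; have gap := level_gap n k hk2 hkn.
have recurrent := mover_recurrent n k hk2 hkn.
have [xi0 [cone sum1]] := limit_point_exists R (mover n k) (target n k) b_homo.
apply: (@uncountable_segment R).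
have xi00 : xi0 != 0.
  apply/eqP => E; move: sum1; rewrite E big1 => [/eqP|i _]; last by rewrite mxE.
  by rewrite eq_sym oner_eq0.
(* The estimates need only the cone condition and a coordinate sum in [1, 2], which all these
   multiples of [xi0] satisfy. *)
suff imS : (fun c : R => c *: xi0) @` `[1 : R, 2]%classic `<=` S.
  have inj : {in `[1 : R, 2]%classic &, injective (fun c : R => c *: xi0)}.
    move=> c c' _ _ /eqP; rewrite -subr_eq0 -scalerBl scaler_eq0 (negbTE xi00).
    by rewrite orbF subr_eq0 => /eqP.
  rewrite -(eq_countable (inj_card_eq inj)).
  exact: sub_countable (subset_card_le imS) cS.
move=> _ [c /= /andP[c1 c2] <-]; rewrite !bnd_simp in c1 c2.
have c0 : 0 <= c by lra.
have cone_c s i :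
    0 <= dot (row i (lattice_basis R (mover n k) (target n k) s)) (c *: xi0).
  by rewrite dotC dotZl dotC mulr_ge0.
have sumE : \sum_j (c *: xi0) 0 j = c.
  by under eq_bigr do rewrite mxE; rewrite -mulr_sumr sum1 mulr1.
have sum_ge1 : 1 <= \sum_j (c *: xi0) 0 j by rewrite sumE.
have sum_le2 : \sum_j (c *: xi0) 0 j <= 2 by rewrite sumE.
have [K [K0 Lsmall Llarge Lsat]] :=
  log_minimum_asymptotics R n k hk2 hkn _ cone_c sum_ge1 sum_le2.
split.
- apply: (limit_point_rat_independent R (mover n k) (target n k)) => //.
  exact: leq_target.
- apply/cvgrPdist_le => eps eps0; have [M [M0 MP]] := sqrt_little_o K eps K0 eps0.
  exists M; split=> [|q Mq]; first exact: num_real.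
  have q0 : 0 < q by exact: lt_trans Mq.
  have /andP[L0 LK] := Lsmall q (ltW q0).
  rewrite sub0r normrN ger0_norm ?divr_ge0 ?(ltW q0) // ler_pdivrMr //.
  exact: le_trans LK (MP q Mq).
apply: limf_einf_pinfty => eps eps0.
  have [M [M0 MP]] := sqrt_little_o K eps K0 eps0.
  exists M => q Mq; have q0 : 0 < q by exact: lt_trans Mq.
  rewrite ler_pdivlMr // mulrBl [_^-1 * q]mulrC.
  by apply: le_trans (Llarge q (ltW q0)); rewrite lerB // MP.
(* Beyond K / eps the additive constant K is at most eps q. *)
move=> M; have [q Mq Lq] := Lsat (Num.max M (Num.max 0 (K / eps))).
move: Mq; rewrite !gt_max => /and3P[Mq q0 Kq]; exists q => //.
rewrite ler_pdivrMr // mulrDl [_^-1 * q]mulrC.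
apply: le_trans Lq _; rewrite lerD2l ltW // mulrC -ltr_pdivrMr //.
Qed.
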